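(* Let $n\ge1$. Let $D$ be a weighted oriented cycle with underlying graph the cycle $C_{2n+1}=(x_1,\dots,x_{2n+1})$, with $V^+\neq\emptyset$ and such that all elements of $V^+$ are sinks, and let $\tilde I=I(D)$ be its edge ideal. Let $w_i=w(x_i)$ for $x_i\in V^+$, $w_v:=\max\{w_i: x_i\in V^+\}$ and $w=\sum_{x_i\in V^+}(w_i-1)$. Then for every integer $s\ge n+1$, $$\mathrm{reg}\bigl(\tilde I^{(s)}/\tilde I^{\,s}\bigr)=(s-n-1)(1+w_v)+2w+2n+1.$$
   Context: A weighted oriented graph $D=(V(D),E(D),w)$ consists of a finite simple graph $G$ (the underlying graph) with $V(G)=V(D)$, an orientation of each edge of $G$ (the pair $(x_i,x_j)\in E(D)$ denotes the edge directed from $x_i$ to $x_j$), and a weight function $w(\cdot):V(D)\to\mathbb{N}=\{1,2,\dots\}$. If $x$ is a source (only arrows leaving $x$), one always assumes $w(x)=1$. Set $V^+=\{x\in V(D): w(x)\neq 1\}$. A vertex $x$ is a sink if all edges at $x$ are directed into $x$. Here $R=K[x_1,\dots,x_{2n+1}]$ with $K$ a field, with the standard grading (vertices are identified with variables). The edge ideal of $D$ is $I(D)=(x_ix_j^{w(x_j)} : (x_i,x_j)\in E(D))\subseteq R$. The symbol $w$ without argument denotes the integer defined in the claim. For a homogeneous ideal $I\subset R$, the $m$-th symbolic power is $I^{(m)}=\bigcap_{p\in \mathrm{Ass}(I)}(I^mR_p\cap R)$, the intersection being over all associated primes of $I$. $\mathrm{reg}$ denotes Castelnuovo–Mumford regularity: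 for a nonzero finitely generated graded $R$-module $M$, $\mathrm{reg}\,M=\max_{0\le i\le\dim M}\{a_i(M)+i\}$, where $a_i(M)=\max\{j\in\mathbb{Z}:[H^i_{\mathfrak m}(M)]_j\neq0\}$ ($-\infty$ if $H^i_{\mathfrak m}(M)=0$) and $\mathfrak m=(x_1,\dots,x_{2n+1})$. *)

(* Defs.v *)
From mathcomp Require Import all_boot all_order all_algebra.
From mathcomp Require Import mpoly.

Set Implicit Arguments.
Unset Strict Implicit.
Unset Printing Implicit Defensive.

Import Order.TTheory GRing.Theory Num.Theory.
Local Open Scope ring_scope.

(** * Weighted oriented graphs *)

(* [arc D x y] means (x, y) \in E(D).  Antisymmetry (with x = y allowed) says
   that the underlying graph has no loop and that each edge has exactly one
   orientation. *)
Record wograph (V : finType) := WOGraph {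
  arc : rel V;
  weight : V -> nat;
  arc_asym : forall x y, ~~ (arc x y && arc y x);
  weight_gt0 : forall x, (0 < weight x)%N;
  weight_source : forall x, (forall y, ~~ arc y x) -> weight x = 1%N
}.

Section Graphs.
Variables (V : finType) (D : wograph V).

Definition underlying : rel V := [rel x y | arc D x y || arc D y x].

Definition sink (x : V) : Prop := forall y, ~~ arc D x y.

Definition Vplus : {set V} := [set x | weight D x != 1%N].

End Graphs.

(* C_N as a simple graph when N >= 3; [ordS] is the successor modulo N. *)
Definition cycle_graph (N : nat) : rel 'I_N :=
  [rel x y | (y == ordS x) || (x == ordS y)].

(** * Ideals, as Prop-valued predicates *)

Section Ideals.
Variable R : comNzRingType.
Implicit Types (I p G : R -> Prop).

Definition is_ideal I : Prop :=
  [/\ I 0, forall f g, I f -> I g -> I (f + g) & forall f g, I g -> I (f * g)].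

Definition ideal_gen G : R -> Prop := fun f =>
  exists (k : nat) (a g : 'I_k -> R),
    (forall i, G (g i)) /\ f = \sum_(i < k) a i * g i.

Definition ideal_pow I (m : nat) : R -> Prop :=
  ideal_gen (fun f => exists g : 'I_m -> R,
    (forall i, I (g i)) /\ f = \prod_(i < m) g i).

Definition is_prime_ideal p : Prop :=
  [/\ is_ideal p, ~ p 1 & forall f g, p (f * g) -> p f \/ p g].

(* p \in Ass(R/I): p is prime and is the annihilator of the class of some f. *)
Definition assoc_prime I p : Prop :=
  is_prime_ideal p /\ exists f, forall g, p g <-> I (g * f).

(* I R_p \cap R, the preimage of the ideal I R_p under R -> R_p: f/1 = a/u in
   R_p with a \in I and u \notin p iff u' f \in I for some u' \notin p. *)
Definition loc_contraction I p : R -> Prop := fun f =>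
  exists u, ~ p u /\ I (u * f).

Definition symbolic_pow I (m : nat) : R -> Prop := fun f =>
  forall p, assoc_prime I p -> loc_contraction (ideal_pow I m) p f.

End Ideals.

Definition edge_ideal (K : fieldType) (d : nat) (D : wograph 'I_d) :
    {mpoly K[d]} -> Prop :=
  ideal_gen (fun f => exists x y : 'I_d,
    arc D x y /\ f = 'X_x * 'X_y ^+ weight D y).

(** * Local cohomology and regularity of a graded module J/I *)

(* The graded module M = J/I over R = K[x_1, ..., x_d] is given by a pair of
   homogeneous ideals I \subset J.  H^i_m(M) is computed by the Cech complex
   on x_1, ..., x_d:
     C^i(M) = \bigoplus_{|S| = i} M_{x_S},  x_S = \prod_{t \in S} x_t,
   whose degree-j strand computes [H^i_m(M)]_j. *)
Section Regularity.
Variables (K : fieldType) (d : nat).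
Local Notation R := {mpoly K[d]}.
Variables J I : R -> Prop.
Implicit Types (S T : {set 'I_d}) (a b : {set 'I_d} -> R).

Definition homog_int (j : int) (f : R) : Prop :=
  if j is Posz e then is_true (f \is e.-homog) else f = 0.

Definition xprod S : R := \prod_(t in S) 'X_t.

(* f / x_S^k = g / x_S^l in M_{x_S}, for f, g \in J. *)
Definition frac_eq S (k : nat) (f : R) (l : nat) (g : R) : Prop :=
  exists N : nat,
    I (xprod S ^+ N * (xprod S ^+ l * f - xprod S ^+ k * g)).

(* A cochain is a finite family of fractions a_S / x_S^k, so that a common
   exponent k may be chosen; its degree is j when deg a_S = j + k |S|. *)
Definition cochain (i : nat) (j : int) (k : nat) a : Prop :=
  forall S, #|S| = i -> J (a S) /\ homog_int (j + (k * #|S|)%:Z) (a S).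

(* Numerator over x_T^k of the T-component of the Cech differential:
   a_{T-t} / x_{T-t}^k is sent to x_t^k a_{T-t} / x_T^k, up to sign. *)
Definition cech_diff (k : nat) a T : R :=
  \sum_(t in T)
     (-1) ^+ #|[set u in T | (u < t)%N]| * ('X_t ^+ k * a (T :\ t)).

Definition cocycle (i : nat) (k : nat) a : Prop :=
  forall T, #|T| = i.+1 -> frac_eq T k (cech_diff k a T) 0 0.

(* C^{-1} = 0: for i = 0 the differential below is an empty sum. *)
Definition coboundary (i : nat) (j : int) (k : nat) a : Prop :=
  exists (l : nat) (b : {set 'I_d} -> R),
    (if i is i'.+1 then cochain i' j l b else True) /\
    forall T, #|T| = i -> frac_eq T k (a T) l (cech_diff l b T).

(* [H^i_m(M)]_j <> 0 *)
Definition lc_nonzero (i : nat) (j : int) : Prop :=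
  exists (k : nat) (a : {set 'I_d} -> R),
    [/\ cochain i j k a, cocycle i k a & ~ coboundary i j k a].

(* a_i(M) = v, where None stands for -oo. *)
Definition a_inv_eq (i : nat) (v : option int) : Prop :=
  if v is Some c then lc_nonzero i c /\ (forall j, lc_nonzero i j -> j <= c)
  else forall j, ~ lc_nonzero i j.

Definition ann : R -> Prop := fun r => forall f, J f -> I (r * f).

(* i <= dim M: there is a chain p_0 < ... < p_i of primes containing Ann(M). *)
Definition le_dim (i : nat) : Prop :=
  exists p : nat -> R -> Prop,
    [/\ forall t, (t <= i)%N -> is_prime_ideal (p t),
        forall f, ann f -> p 0%N f
      & forall t, (t < i)%N ->
          (forall f, p t f -> p t.+1 f) /\ exists f, p t.+1 f /\ ~ p t f].

(* reg M = r, i.e. r is the maximum of the a_i(M) + i for 0 <= i <= dim M. *)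
Definition reg_eq (r : int) : Prop :=
  (exists i c, [/\ le_dim i, a_inv_eq i (Some c) & c + i%:Z = r]) /\
  (forall i, le_dim i ->
     exists v, a_inv_eq i v /\ (if v is Some c then c + i%:Z <= r else True)).

End Regularity.

(* Main.v *)
Require Import Defs.
From mathcomp Require Import all_boot all_order all_algebra.
From mathcomp Require Import mpoly zify.

(* Each vertex of V^+ is a sink, so its neighbours have weight 1 and I is the
   image of the edge ideal of C_{2n+1} under x_v -> x_v^{w(v)}.  With
   b_v = floor (m_v / w_v), a monomial x^m lies in I^s iff b contains s edges
   (with multiplicity), and in I^(s) iff b(C) >= s for every vertex cover C.
   By a Koenig theorem for odd cycles, s edges fit into b iff b(C) >= s for all
   covers and sum b >= 2s.  Hence every x_v is nilpotent on M = I^(s)/I^s, so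
   M has dimension 0, H^0_m(M) = M, and reg M is the largest degree of a
   monomial of I^(s) outside I^s.  For such a monomial sum b <= 2s - 1, and then
   b is a half-integral combination of edges with all coefficients positive,
   which bounds the degree; equality holds for
   b = (1, ..., 1) + (s - n - 1) * (an edge at the heaviest vertex),
   with m_v = w_v b_v + w_v - 1. *)

Set Implicit Arguments.
Unset Strict Implicit.
Unset Printing Implicit Defensive.

(** * Koenig duality on paths and odd cycles *)

(** Here [y i] is the multiplicity of the edge between [i - 1] and [i], so [y 0] and [y m.+1] belong
    to absent edges. The induction saturates the last edge with [t = min (b m) (b m.+1)], lowers
    [b m] by [t], and recurses. The cover of the shorter path is extended so that it holds exactly
    one end of the last edge, at an extra cost of exactly [t]: it keeps [m] if [m] was chosen, and
    otherwise takes the cheaper end. *)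
Lemma path_konig (m : nat) (b : nat -> nat) :
  exists (y : nat -> nat) (c : nat -> bool),
    [/\ y 0 = 0 /\ y m.+1 = 0,
        forall i, i <= m -> y i + y i.+1 <= b i,
        forall i, i < m -> c i || c i.+1
      & \sum_(i < m.+1) c i * b i <= \sum_(i < m.+1) y i].
Proof.
elim: m b => [|m IHm] b.
  by exists (fun=> 0), (fun=> false); split=> //; rewrite !big_ord_recl !big_ord0.
pose t := minn (b m) (b m.+1).
pose b' i := if i == m then b m - t else b i.
have [y [c [[y0 ym] hy hc hsum]]] := IHm b'.
pose z i := if i == m.+1 then t else if i == m.+2 then 0 else y i.
have zE i : i <= m -> z i = y i by move=> le_im; rewrite /z !ifF //; lia.
have zm : z m.+1 = t by rewrite /z eqxx.
have zm1 : z m.+2 = 0 by rewrite /z eqxx ifF //; lia.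
pose d i := if i == m.+1 then (b m.+1 <= b m) && ~~ c m
            else if i == m then c m || (b m < b m.+1) else c i.
have dE i : i < m -> d i = c i by move=> lt_im; rewrite /d !ifF //; lia.
have dm : d m = c m || (b m < b m.+1) by rewrite /d eqxx ifF //; lia.
have dm1 : d m.+1 = (b m.+1 <= b m) && ~~ c m by rewrite /d eqxx.
exists z, d; split.
- by rewrite zE.
- move=> i; rewrite leq_eqVlt ltnS => /orP[/eqP->|le_im]; first by rewrite zm zm1; lia.
  have := hy i le_im; rewrite (zE i) // /b'; case: (eqVneq i m) => [->|ne_im].
    by rewrite ym zm; lia.
  by rewrite zE //; lia.
- move=> i; rewrite ltnS leq_eqVlt => /orP[/eqP->|lt_im].
    by rewrite dm dm1; case: (c m) => //=; case: ltnP.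
  rewrite dE //; case: (eqVneq i.+1 m) => [e|ne_im].
    by have := hc i lt_im; rewrite e dm; case: (c i) => //= ->.
  by rewrite dE ?hc //; lia.
rewrite big_ord_recr [X in _ <= X]big_ord_recr /= zm dm1.
have -> : \sum_(i < m.+1) z i = \sum_(i < m.+1) y i.
  by apply: eq_bigr => i _; apply: zE; rewrite -ltnS.
apply: leq_trans (leq_add hsum (leqnn t)).
rewrite !big_ord_recr /= dm /b' eqxx.
have -> : \sum_(i < m) d i * b i = \sum_(i < m) c i * (if i == m :> nat then b m - t else b i).
  by apply: eq_bigr => i _; rewrite dE // ifF //; have := ltn_ord i; lia.
rewrite -!addnA leq_add2l /t.
by case: (c m) => /=; case: leqP => /=; lia.
Qed.

(* The covers [A] and [B] of a path can be spliced at [i, i+1] unless they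
   alternate there; if no splice is possible they are complementary. *)
Lemma splice_covers (n s : nat) (b : nat -> nat) (A B : nat -> bool) :
  (forall c : nat -> bool, (forall i, i < 2 * n -> c i || c i.+1) ->
     c (2 * n) || c 0 -> s <= \sum_(i < (2 * n).+1) c i * b i) ->
  2 * s <= \sum_(i < (2 * n).+1) b i ->
  (forall i, i < 2 * n -> A i || A i.+1) ->
  (forall i, i < 2 * n -> B i || B i.+1) ->
  A 0 -> A (2 * n) -> ~~ B 0 -> ~~ B (2 * n) ->
  2 * s <= \sum_(i < (2 * n).+1) A i * b i + \sum_(i < (2 * n).+1) B i * b i.
Proof.
move=> hcov hsum hA hB A0 An B0 Bn.
have alt k : k <= 2 * n ->
    (exists i, [&& i < k, A i || B i.+1 & B i || A i.+1]) \/
    (forall i, i <= k -> A i = ~~ odd i /\ B i = odd i).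
  elim: k => [_|k IHk lt_kn].
    by right=> i; rewrite leqn0 => /eqP ->; rewrite A0 (negPf B0).
  have [[i /andP[lt_ik hi]]|alt] := IHk (ltnW lt_kn).
    by left; exists i; rewrite hi ltnS ltnW.
  have [hk|] := boolP ((A k || B k.+1) && (B k || A k.+1)).
    by left; exists k; rewrite ltnSn.
  have := hA k lt_kn; have := hB k lt_kn; have [-> ->] := alt k (leqnn k) => hb ha hk.
  right=> i; rewrite leq_eqVlt => /orP[/eqP->|/alt //]; move: hb ha hk => /=.
  by case: (odd k); case: (A k.+1); case: (B k.+1).
rewrite -big_split /=.
have [[i /and3P[lt_in AB BA]]|alt'] := alt _ (leqnn (2 * n)); last first.
  apply: leq_trans hsum _; apply: leq_sum => i _.
  by have [|-> ->] := alt' i; [rewrite -ltnS ltn_ord | case: (odd i); lia].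
(* Each spliced cover contains one of the ends [0] and [2 * n], hence also covers the closing edge,
   and together they use every vertex as often as [A] and [B] do. *)
pose c1 j := if j <= i then A j else B j.
pose c2 j := if j <= i then B j else A j.
have s1 : s <= \sum_(i < (2 * n).+1) c1 i * b i.
  apply: hcov => [j lt_jn|]; last by rewrite /c1 A0 leq0n orbT.
  rewrite /c1; case: (ltngtP j i) => // [_|_|->//]; [exact: hA|exact: hB].
have s2 : s <= \sum_(i < (2 * n).+1) c2 i * b i.
  apply: hcov => [j lt_jn|]; last by rewrite /c2 leqNgt lt_in An.
  rewrite /c2; case: (ltngtP j i) => // [_|_|->//]; [exact: hB|exact: hA].
have := leq_add s1 s2; rewrite -big_split addnn -mul2n => /leq_trans; apply.
by apply: leq_sum => j _; rewrite /c1 /c2; case: (j <= i); rewrite //= addnC.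
Qed.

Definition vertex_cover (N : nat) (C : {set 'I_N}) : bool :=
  [forall i, (i \in C) || (ordS i \in C)].

Lemma sum_mem_ord (N : nat) (C : {set 'I_N}) (b : 'I_N -> nat) :
  \sum_(i in C) b i = \sum_i (i \in C) * b i.
Proof. by rewrite big_mkcond; apply: eq_bigr => i _; case: (i \in C); lia. Qed.

Lemma ordS_max (m : nat) : ordS (ord_max : 'I_m.+1) = ord0.
Proof. by apply: val_inj; rewrite /= modnn. Qed.

(* [y i] is the multiplicity of the edge between [i - 1] and [i].  The proof
   deletes the closing edge, giving it the largest multiplicity [t] that keeps
   every path cover containing both ends large enough; [splice_covers] handles
   the path covers containing neither end. *)
Lemma odd_cycle_konig (n s : nat) (b : 'I_(2 * n).+1 -> nat) :
  (forall C, vertex_cover C -> s <= \sum_(i in C) b i) ->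
  2 * s <= \sum_i b i -> 0 < n ->
  exists y : 'I_(2 * n).+1 -> nat,
    (forall i, y i + y (ordS i) <= b i) /\ s <= \sum_i y i.
Proof.
move=> hcov hsum n_gt0; pose N := (2 * n).+1.
pose bn k := b (inord k).
have bnE (i : 'I_N) : bn i = b i by rewrite /bn inord_val.
have hcovn (c : nat -> bool) : (forall i, i < 2 * n -> c i || c i.+1) ->
    c (2 * n) || c 0 -> s <= \sum_(i < N) c i * bn i.
  move=> hc c0; have := hcov [set i : 'I_N | c i].
  rewrite sum_mem_ord; under eq_bigr => i _ do rewrite inE -bnE.
  apply; apply/forallP => i; rewrite !inE.
  have := ltn_ord i; rewrite ltnS leq_eqVlt => /orP[/eqP ei|lt_in].
    by have -> : i = ord_max by [exact: val_inj]; rewrite ordS_max.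
  by rewrite /= modn_small ?ltnS // hc.
have hsumn : 2 * s <= \sum_(i < N) bn i by rewrite (eq_bigr b).
pose path_cover (C : {set 'I_N}) :=
  [forall i : 'I_N, (i < 2 * n) ==> ((i \in C) || (inord i.+1 \in C))].
have path_coverP C : path_cover C ->
    forall i, i < 2 * n -> (inord i \in C) || (inord i.+1 \in C).
  by move=> /forallP hC i lt_in; have := hC (inord i); rewrite inordK ?lt_in // ltnW.
pose both C := path_cover C && (inord 0 \in C) && (inord (2 * n) \in C).
have bothT : both setT by rewrite /both !inE !andbT; apply/forallP => i; rewrite !inE implybT.
pose F (C : {set 'I_N}) := \sum_(i in C) b i.
have FE C : F C = \sum_(i < N) (inord i \in C) * bn i.
  by rewrite /F sum_mem_ord; apply: eq_bigr => i _; rewrite inord_val bnE.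
have [A /andP[/andP[covA A0] An] minA] := arg_minnP F bothT.
(* A closing edge of multiplicity [t] lowers the weight of a cover containing both ends by [2 t] and
   adds [t] to the packing, so the cheapest such cover [A] allows [t <= F A - s]. *)
pose t := minn (minn (bn 0) (bn (2 * n))) (F A - s).
have FA : s <= F A.
  rewrite FE; apply: (hcovn (fun k => inord k \in A)); last by rewrite A0 orbT.
  exact: path_coverP.
pose b' i := bn i - (if (i == 0) || (i == 2 * n) then t else 0).
have b'0 : b' 0 = bn 0 - t by [].
have b'n : b' (2 * n) = bn (2 * n) - t by rewrite /b' eqxx orbT.
have t0 : t <= bn 0 by rewrite /t; lia.
have tn : t <= bn (2 * n) by rewrite /t; lia.
have tE : t = minn (minn (bn 0) (bn (2 * n))) (F A - s) by [].
clearbody t.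
have [y [c [[y0 yN] hy hc hle]]] := path_konig (2 * n) b'.
(* Index [0] is the closing edge, and index [N] repeats it as the successor of [2 * n]. *)
pose z i := if (i == 0) || (i == N) then t else y i.
have [k ek] : exists k, 2 * n = k.+1 by exists (2 * n).-1; lia.
have ends (f : nat -> nat) :
    \sum_(i < N) f i = f 0 + \sum_(i < k) f i.+1 + f (2 * n).
  by rewrite /N ek big_ord_recr big_ord_recl.
have sumz : \sum_(i < N) z i = t + \sum_(i < N) y i.
  rewrite (ends z) (ends y) y0 add0n !addnA {1}/z /=; congr (_ + _ + _); last first.
    by rewrite /z ifF //; lia.
  by apply: eq_bigr => i _; rewrite /z ifF //; have := ltn_ord i; lia.
have sumc : \sum_(i < N) c i * bn i
    = \sum_(i < N) c i * b' i + c 0 * t + c (2 * n) * t.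
  rewrite (ends (fun i => c i * bn i)) (ends (fun i => c i * b' i)) b'0 b'n.
  have -> : \sum_(i < k) c i.+1 * b' i.+1 = \sum_(i < k) c i.+1 * bn i.+1.
    apply: eq_bigr => i _; rewrite /b' ifF ?subn0 //.
    by have := ltn_ord i; lia.
  by case: (c 0); case: (c (2 * n)); lia.
have sumt : s <= \sum_(i < N) z i.
  rewrite sumz; apply: leq_trans (leq_add (leqnn t) hle).
  rewrite -/N; have le_one : c (2 * n) || c 0 -> s <= \sum_(i < N) c i * bn i.
    exact: hcovn.
  case c0: (c 0); case cn: (c (2 * n)); rewrite c0 cn in sumc le_one.
  - pose C : {set 'I_N} := [set i : 'I_N | c i].
    have bothC : both C.
      rewrite /both !inE !inordK ?ltnS // c0 cn !andbT.
      apply/forallP => i; apply/implyP => lt_in; rewrite !inE inordK ?ltnS //.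
      exact: hc.
    have FC : F C = \sum_(i < N) c i * bn i.
      by rewrite FE; apply: eq_bigr => i _; rewrite inE inord_val.
    by have := minA C bothC; rewrite FC; lia.
  - by have := le_one isT; lia.
  - by have := le_one isT; lia.
  (* When [c] contains neither end, each value of the minimum [t] has its own bound: splicing with
     [A] serves [t = F A - s], and adding an end to [c] serves the capacity of that end. *)
  have spl : 2 * s <= F A + \sum_(i < N) c i * bn i.
    rewrite FE; apply: (splice_covers (A := fun k => inord k \in A)) => //;
      by [exact: path_coverP | rewrite c0 | rewrite cn].
  have add_end e : e \in [:: 0; 2 * n] -> s <= bn e + \sum_(i < N) c i * bn i.
    move=> he; have lt_e : e < N by move: he; rewrite !inE => /orP[] /eqP ->; lia.
    have := hcovn (fun i => (i == e) || c i).
    have -> : \sum_(i < N) ((i == e :> nat) || c i) * bn i = bn e + \sum_(i < N) c i * bn i.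
      rewrite (bigD1 (Ordinal lt_e)) // [in RHS](bigD1 (Ordinal lt_e)) //= eqxx.
      have -> : c e = false by move: he; rewrite !inE => /orP[] /eqP ->.
      rewrite mul1n mul0n add0n; congr (_ + _); apply: eq_bigr => i ne_i.
      by congr (nat_of_bool _ * _); rewrite -[(i : nat) == e]/(i == Ordinal lt_e) (negPf ne_i).
    apply=> [i lt_in|]; first by have := hc i lt_in; case/orP => ->; rewrite !orbT.
    by move: he; rewrite !inE => /orP[] /eqP ->; rewrite eqxx ?orbT.
  have := add_end 0; have := add_end (2 * n); rewrite !inE !eqxx orbT => /(_ isT) hn /(_ isT) h0.
  by rewrite -/N; lia.
exists (fun i : 'I_N => z i); split=> // i; rewrite -bnE.
have := ltn_ord i; rewrite ltnS leq_eqVlt => /orP[/eqP ei|lt_in].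
  have -> : i = ord_max by [exact: val_inj]; rewrite ordS_max /=.
  have := hy (2 * n) (leqnn _); rewrite /b' eqxx orbT /z ifF; last by lia.
  by rewrite yN /=; lia.
rewrite /= modn_small ?ltnS //; have := hy i (ltnW lt_in); rewrite /b' /z.
have -> : (i.+1 == 0) || (i.+1 == N) = false by rewrite /N; lia.
have -> : (i == N :> nat) = false by rewrite /N; lia.
have -> : (i == 2 * n :> nat) = false by lia.
rewrite !orbF; case: eqP => [->|_]; last by rewrite subn0.
by rewrite y0 add0n; move: t0; move: (bn 0) (y 1) => p q; lia.
Qed.

(** * Alternating covers and the degree bound *)

(** For [N = 2n + 1] these are the vertices at forward distance 0, 2, ..., 2n from [i]. The term
    [i <= v] corrects the parity change on passing from [2n] to [0]. *)
Definition alternating_cover (N : nat) (i : 'I_N) : {set 'I_N} :=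
  [set v : 'I_N | odd (i + v) (+) (i <= v)].

Lemma ordS_case (m : nat) (i : 'I_m.+1) :
  (i < m /\ ordS i = i.+1 :> nat) \/ (i = m :> nat /\ ordS i = 0 :> nat).
Proof.
have := ltn_ord i; rewrite ltnS leq_eqVlt => /orP[/eqP e|lt_im].
  by right; split=> //=; rewrite e modnn.
by left; split=> //=; rewrite modn_small.
Qed.

Lemma sum_ordS (N : nat) (F : 'I_N -> nat) : \sum_i F (ordS i) = \sum_i F i.
Proof. by rewrite [RHS](reindex _ (onW_bij _ (ordS_bij _))). Qed.

Lemma alternating_cover_is_cover (n : nat) (i : 'I_(2 * n).+1) :
  vertex_cover (alternating_cover i).
Proof.
apply/forallP => v; rewrite !inE; have lt_i := ltn_ord i.
by case: (ordS_case v) => [[lt_v ->]|[-> ->]]; lia.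
Qed.

(** The two covers contain every vertex exactly once, except [i], which is the first vertex of one
    and the last of the other. *)
Lemma alternating_cover_sum (n : nat) (i : 'I_(2 * n).+1) (b : 'I_(2 * n).+1 -> nat) :
  \sum_(v in alternating_cover i) b v + \sum_(v in alternating_cover (ordS i)) b v
  = \sum_v b v + b i.
Proof.
have mem2 v : (v \in alternating_cover i) + (v \in alternating_cover (ordS i))
    = 1 + (v == i).
  have [->|ne_vi] := eqVneq v i; rewrite !inE.
    by case: (ordS_case i) => [[lt_i ->]|[e ->]]; rewrite ?e; lia.
  have {}ne_vi : v <> i :> nat by move=> /val_inj e; rewrite e eqxx in ne_vi.
  have := ltn_ord v.
  by case: (ordS_case i) => [[lt_i ->]|[e ->]]; rewrite ?e; lia.
rewrite !sum_mem_ord -big_split /=.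
under eq_bigr => v _ do rewrite -mulnDl mem2 mulnDl mul1n.
rewrite big_split /= (bigD1 i) //= [X in _ + X](bigD1 i) //= eqxx mul1n.
rewrite [X in _ + (_ + X)]big1 ?addn0 // => v ne_vi.
by rewrite (negPf ne_vi).
Qed.

(* The unique solution of [y i + y (ordS i) = b i] is half of
   [z i = 2 b(C_i) - sum b], where C_i is the alternating cover; the hypotheses
   make every [z i] positive. *)
Lemma weighted_degree_bound (n s wv : nat) (b w : 'I_(2 * n).+1 -> nat) :
  (forall C, vertex_cover C -> s <= \sum_(i in C) b i) ->
  \sum_i b i < 2 * s ->
  (forall i, w i + w (ordS i) <= wv.+1) ->
  n.+1 <= s /\ \sum_i w i * b i <= \sum_i w i + (s - n.+1) * wv.+1.
Proof.
move=> hcov hsum hw; pose beta := \sum_i b i.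
pose B (i : 'I_(2 * n).+1) := \sum_(v in alternating_cover i) b v.
have leB i : s <= B i by apply: hcov; exact: alternating_cover_is_cover.
pose z i := 2 * B i - beta.
have ltz i : beta < 2 * B i by have := leB i; rewrite /beta; lia.
have z_gt0 i : 0 < z i by have := ltz i; rewrite /z; lia.
have zz i : z i + z (ordS i) = 2 * b i.
  have := alternating_cover_sum i b; rewrite -/(B i) -/(B (ordS i)) -/beta.
  by have := ltz i; have := ltz (ordS i); rewrite /z; lia.
have sumz : \sum_i z i = beta.
  have : \sum_i (z i + z (ordS i)) = \sum_i 2 * b i by apply: eq_bigr.
  by rewrite big_split /= (sum_ordS z) -big_distrr /= -/beta; lia.
have le_beta : (2 * n).+1 <= beta.
  rewrite -sumz -[X in X <= _](card_ord (2 * n).+1) -sum1_card.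
  exact: leq_sum.
split; first by rewrite /beta in le_beta; lia.
have /esym /= reidxw := sum_ordS (fun i => z i * w i).
have dbl : 2 * \sum_i w i * b i = \sum_i z (ordS i) * (w i + w (ordS i)).
  transitivity (\sum_i w i * (z i + z (ordS i))).
    by rewrite big_distrr; apply: eq_bigr => i _; rewrite zz mulnCA.
  under eq_bigr => i _ do rewrite mulnDr mulnC [w i * _]mulnC.
  under [RHS]eq_bigr => i _ do rewrite mulnDr.
  by rewrite !big_split [X in X + _ = _]reidxw addnC.
(* Termwise, with [z] at [ordS i], this says that [z - 1] times [wv.+1 - (w i + w (ordS i))] is
   nonnegative. *)
have le_dbl : 2 * \sum_i w i * b i + (2 * n).+1 * wv.+1
    <= 2 * \sum_i w i + beta * wv.+1.
  have -> : (2 * n).+1 * wv.+1 = \sum_(i < (2 * n).+1) wv.+1.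
    by rewrite sum_nat_const card_ord.
  have -> : 2 * \sum_i w i = \sum_i (w i + w (ordS i)).
    by rewrite mul2n -addnn big_split /= (sum_ordS w).
  have /= reidxz := sum_ordS (fun i => z i * wv.+1).
  rewrite dbl -sumz big_distrl /= -reidxz -!big_split /=.
  apply: leq_sum => i _; have := hw i; have := z_gt0 (ordS i).
  by move: (z _) (w i + _) => p q; nia.
move: le_dbl hsum le_beta; rewrite -/beta; clear.
move: (\sum_i w i * b i) (\sum_i w i) beta wv.+1 => p q r V le_pq lt_r le_r.
have le_rV : (r - (2 * n).+1) * V <= 2 * ((s - n.+1) * V).
  by rewrite mulnA leq_mul2r; apply/orP; right; lia.
have : r * V = (2 * n).+1 * V + (r - (2 * n).+1) * V by rewrite -mulnDl subnKC.
by lia.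
Qed.

(** Each vertex meets two of the [2n + 1] edges, so twice the size of a cover is at least
    [2n + 1]. *)
Lemma vertex_cover_card (n : nat) (C : {set 'I_(2 * n).+1}) :
  vertex_cover C -> n < #|C|.
Proof.
move=> /forallP hC; rewrite -sum1_card sum_mem_ord.
have : \sum_(i < (2 * n).+1) 1 <= \sum_i (i \in C) * 1 + \sum_i (ordS i \in C) * 1.
  rewrite -big_split; apply: leq_sum => i _.
  by have := hC i; case: (i \in C); case: (ordS i \in C).
have <- : \sum_i (i \in C) * 1 = \sum_i (ordS i \in C) * 1.
  by rewrite (sum_ordS (fun i => (i \in C) * 1)).
by rewrite sum1_card card_ord; move: (\sum_i _) => S; lia.
Qed.

Lemma vertex_cover_minset (N : nat) (C : {set 'I_N}) :
  vertex_cover C -> exists2 C', minset (@vertex_cover N) C' & C' \subset C.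
Proof. by move=> /minset_exists[C' minC' sub]; exists C'. Qed.

Lemma leq_sum_sub (I : finType) (A B : {set I}) (b : I -> nat) :
  A \subset B -> \sum_(i in A) b i <= \sum_(i in B) b i.
Proof.
by move=> sAB; rewrite [X in _ <= X](big_setID A) (setIidPr sAB) leq_addr.
Qed.

Import Order.TTheory GRing.Theory Num.Theory.
Local Open Scope ring_scope.

(** * Generators and powers of ideals *)

Section IdealGeneration.
Variable R : comNzRingType.
Implicit Types (I J G : R -> Prop).

Lemma ideal_gen_incl G g : G g -> ideal_gen G g.
Proof.
move=> Gg; exists 1%N, (fun=> 1), (fun=> g); split=> //.
by rewrite big_ord1 mul1r.
Qed.

Lemma ideal_gen_ideal G : is_ideal (ideal_gen G).
Proof.
split=> [|f g [k [a [u [Gu ->]]]] [l [b [v [Gv ->]]]]|f g [k [a [u [Gu ->]]]]].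
- by exists 0%N, (fun=> 0), (fun=> 0); split=> [[]//|]; rewrite big_ord0.
- pose glue (x : 'I_k -> R) (y : 'I_l -> R) (i : 'I_(k + l)) :=
    match split i with inl i => x i | inr i => y i end.
  exists (k + l)%N, (glue a b), (glue u v); split.
    by move=> i; rewrite /glue; case: (split i).
  rewrite big_split_ord /glue; congr (_ + _); apply: eq_bigr => i _.
    by rewrite -[lshift _ _]/(unsplit (inl i)) unsplitK.
  by rewrite -[rshift _ _]/(unsplit (inr i)) unsplitK.
- exists k, (fun i => f * a i), u; split=> //.
  by rewrite mulr_sumr; apply: eq_bigr => i _; rewrite mulrA.
Qed.

Lemma ideal_sum J (T : Type) (r : seq T) (P : pred T) (F : T -> R) :
  is_ideal J -> (forall i, P i -> J (F i)) -> J (\sum_(i <- r | P i) F i).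
Proof. by move=> [J0 JD _] JF; elim/big_ind: _. Qed.

Lemma ideal_gen_sub G J f :
  is_ideal J -> (forall g, G g -> J g) -> ideal_gen G f -> J f.
Proof.
move=> idJ GJ [k [a [g [Gg ->]]]]; apply: ideal_sum => // i _.
by case: idJ => _ _; apply; apply: GJ.
Qed.

(** Convertible to the generating predicate inside [ideal_pow]. *)
Definition ideal_prod I (m : nat) (f : R) : Prop :=
  exists g : 'I_m -> R, (forall i, I (g i)) /\ f = \prod_(i < m) g i.

Lemma ideal_prod0 I : ideal_prod I 0 1.
Proof. by exists (fun=> 0); split=> [[]//|]; rewrite big_ord0. Qed.

Lemma ideal_prod1 I f : I f -> ideal_prod I 1 f.
Proof. by move=> If; exists (fun=> f); rewrite big_ord1. Qed.

Lemma ideal_prodM I a b f g :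
  ideal_prod I a f -> ideal_prod I b g -> ideal_prod I (a + b) (f * g).
Proof.
move=> [u [Iu ->]] [v [Iv ->]].
exists (fun i => match split i with inl i => u i | inr i => v i end); split.
  by move=> i; case: (split i).
rewrite big_split_ord; congr (_ * _); apply: eq_bigr => i _.
  by rewrite -[lshift _ _]/(unsplit (inl i)) unsplitK.
by rewrite -[rshift _ _]/(unsplit (inr i)) unsplitK.
Qed.

Lemma ideal_prodX I f k : I f -> ideal_prod I k (f ^+ k).
Proof.
move=> If; elim: k => [|k IHk]; first exact: ideal_prod0.
by rewrite exprS; apply: ideal_prodM (ideal_prod1 If) IHk.
Qed.

Lemma ideal_prod_le I a b f :
  (a <= b)%N -> ideal_prod I b f -> ideal_pow I a f.
Proof.
move=> /subnKC <- [g [Ig ->]]; rewrite big_split_ord /= mulrC.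
case: (ideal_gen_ideal (ideal_prod I a)) => _ _; apply; apply: ideal_gen_incl.
by exists (fun i => g (lshift (b - a) i)).
Qed.

End IdealGeneration.

(** * Monomial ideals and cancellation-free products *)

Section MonomialIdeals.
Variables (K : fieldType) (d : nat).
Local Notation R := {mpoly K[d]}.
Implicit Types (f g u : R) (m : 'X_{1..d}) (P Q : 'X_{1..d} -> Prop).

Definition monomial_ideal P f : Prop := forall m, m \in msupp f -> P m.

Lemma monomial_idealX P m : monomial_ideal P 'X_[m] <-> P m.
Proof.
split=> [|Pm m']; first by apply; rewrite msuppX mem_head.
by rewrite msuppX inE => /eqP ->.
Qed.

Lemma monomial_idealM P Q S f g :
  (forall m1 m2, P m1 -> Q m2 -> S (m1 + m2)%MM) ->
  monomial_ideal P f -> monomial_ideal Q g -> monomial_ideal S (f * g).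
Proof.
move=> PQ Pf Qg m /msuppM_le/allpairsP[[m1 m2] /= [m1f m2g ->]].
by apply: PQ; [exact: Pf | exact: Qg].
Qed.

Lemma monomial_idealMX P f m :
  monomial_ideal P (f * 'X_[m]) <-> (forall m', m' \in msupp f -> P (m + m')%MM).
Proof.
split=> [Pfm m' m'f|Pf m'].
  by apply: Pfm; rewrite (perm_mem (msuppMX _ _)) map_f.
by rewrite (perm_mem (msuppMX _ _)) => /mapP[m1 m1f ->]; apply: Pf.
Qed.

Lemma monomial_ideal_ideal P :
  (forall m1 m2, P m2 -> P (m1 + m2)%MM) -> is_ideal (monomial_ideal P).
Proof.
move=> upP; split=> [m|f g Pf Pg m|f g Pg].
- by rewrite msupp0.
- by move=> /msuppD_le; rewrite mem_cat => /orP[/Pf|/Pg].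
- by apply: (@monomial_idealM (fun=> True) P) => // m1 m2 _; apply: upP.
Qed.

Lemma monomial_ideal_sub P (J : R -> Prop) f :
  is_ideal J -> (forall m, P m -> J 'X_[m]) -> monomial_ideal P f -> J f.
Proof.
move=> idJ PJ Pf; rewrite (mpolyE f) big_seq; apply: ideal_sum => // m mf.
by rewrite -mul_mpolyC; case: idJ => _ _; apply; apply: PJ; apply: Pf.
Qed.

(** By hypothesis a single pair of support monomials can have the given product, so one term of the
    convolution survives. *)
Lemma mcoeffM_extremal u f m1 m2 :
  (forall p q, p \in msupp u -> q \in msupp f -> (p + q = m1 + m2)%MM -> p = m1) ->
  (u * f)@_(m1 + m2) = u@_m1 * f@_m2.
Proof.
move=> ext; rewrite {1}[u]mpolyE mulr_suml raddf_sum /=.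
have termE p : (u@_p *: 'X_[p] * f)@_(m1 + m2) = u@_p * ('X_[p] * f)@_(m1 + m2).
  by rewrite -scalerAl mcoeffZ.
have mainE : ('X_[m1] * f)@_(m1 + m2) = f@_m2 by rewrite mulrC mcoeffMX.
have zero p : p \in msupp u -> p != m1 -> ('X_[p] * f)@_(m1 + m2) = 0.
  move=> pu; apply: contraNeq; rewrite -mcoeff_msupp mulrC (perm_mem (msuppMX f p)).
  by move=> /mapP[q qf e]; apply/eqP/(ext p q).
have [m1u|m1u] := boolP (m1 \in msupp u); last first.
  rewrite (memN_msupp_eq0 m1u) mul0r big_seq big1 // => p pu.
  by rewrite termE zero ?mulr0 //; apply: contraNneq m1u => <-.
rewrite (bigD1_seq m1) //= termE mainE big_seq_cond big1 ?addr0 //.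
by move=> p /andP[pu ne]; rewrite termE zero ?mulr0.
Qed.

Lemma mem_seq_min (disp : Order.disp_t) (T : orderType disp) (r : seq T) x0 :
  x0 \in r -> exists2 x, x \in r & forall y, y \in r -> (x <= y)%O.
Proof.
elim: r x0 => // a r IHr x0 _; case: r IHr => [_|b r IHr].
  by exists a; rewrite ?mem_head // => y; rewrite inE => /eqP ->.
have [x xr minx] := IHr b (mem_head _ _).
have [le_ax|/ltW le_xa] := leP a x.
  exists a; first exact: mem_head.
  by move=> y; rewrite inE => /orP[/eqP-> //|/minx]; apply: le_trans.
exists x; first by rewrite inE xr orbT.
by move=> y; rewrite inE => /orP[/eqP-> //|/minx].
Qed.

(* Extremal monomials: the lowest [phi]-degree part of [u] and the lowest
   [phi]-degree part of the bad monomials of [f] cannot cancel in [u * f]. *)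
Lemma monomial_ideal_primary (phi : 'X_{1..d} -> nat) (good : pred 'X_{1..d}) u f :
  (forall m1 m2, phi (m1 + m2)%MM = (phi m1 + phi m2)%N) ->
  (forall m1 m2, good m2 -> good (m1 + m2)%MM) ->
  (forall m1 m2, phi m1 = 0%N -> good (m1 + m2)%MM -> good m2) ->
  has (fun m => phi m == 0%N) (msupp u) ->
  monomial_ideal good (u * f) -> monomial_ideal good f.
Proof.
move=> phiD upg lowg /hasP[m0 m0u m0phi] guf m mf; apply/negPn/negP => bad_m.
have [m1] : exists2 m, m \in [seq m <- msupp u | phi m == 0%N]
    & forall m', m' \in [seq m <- msupp u | phi m == 0%N] -> (m <= m')%O.
  by apply: (mem_seq_min (x0 := m0)); rewrite mem_filter m0phi.
rewrite mem_filter => /andP[/eqP phi1 m1u] min1.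
pose badk k := has (fun m => ~~ good m && (phi m == k)) (msupp f).
have exk : exists k, badk k by exists (phi m); apply/hasP; exists m; rewrite ?bad_m /=.
case: (ex_minnP exk) => k /hasP[m2' m2'f bad2'] mink.
pose low := [seq m <- msupp f | ~~ good m && (phi m == k)].
have [m2] : exists2 m, m \in low & forall m', m' \in low -> (m <= m')%O.
  by apply: (mem_seq_min (x0 := m2')); rewrite mem_filter bad2'.
rewrite mem_filter => /andP[/andP[bad2 /eqP phi2] m2f] min2.
have : ~~ good (m1 + m2)%MM by apply: contra bad2; apply: lowg.
apply/negP/negPn; apply: guf.
rewrite mcoeff_msupp mcoeffM_extremal ?mulf_neq0 -?mcoeff_msupp //.
move=> p q pu qf epq.
(* A competing pair [p], [q] has a bad product, so [q] is bad; minimality of [k] then puts both in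
   the lowest [phi]-degrees, where the monomial order settles [p = m1]. *)
have bad_q : ~~ good q by apply: contra bad2 => /(upg p); rewrite epq; apply: lowg.
have le_kq : (k <= phi q)%N by apply: mink; apply/hasP; exists q; rewrite ?bad_q /=.
have ephi : (phi p + phi q = k)%N by rewrite -phiD epq phiD phi1 phi2.
have [phi_p phi_q] : phi p = 0%N /\ phi q = k by move: ephi le_kq; clear; lia.
have le_1p : (m1 <= p)%O by apply: min1; rewrite mem_filter pu phi_p.
have le_2q : (m2 <= q)%O by apply: min2; rewrite mem_filter qf bad_q phi_q eqxx.
apply/eqP; rewrite eq_le le_1p andbT -(lemc_add2l p m1 q) epq lemc_add2r.
exact: le_2q.
Qed.

End MonomialIdeals.

(** * Ordinary and symbolic powers for a weighted odd cycle *)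

Section WeightedOddCycle.
Variables (K : fieldType) (n : nat).
Hypothesis n_gt0 : (0 < n)%N.
Local Notation N := (2 * n).+1.
Variable w : 'I_N -> nat.
Hypothesis w_gt0 : forall i, (0 < w i)%N.
Local Notation R := {mpoly K[N]}.
Implicit Types (f g : R) (m : 'X_{1..N}).

Definition edge_mnm (i : 'I_N) : 'X_{1..N} :=
  (U_(i) *+ w i + U_(ordS i) *+ w (ordS i))%MM.

(* [m] is a multiple of a product of [s] edge monomials; [y i] is the
   multiplicity of the edge between [i - 1] and [i]. *)
Definition edge_product (s : nat) m : Prop :=
  exists y : 'I_N -> nat,
    (forall i, ((y i + y (ordS i)) * w i <= m i)%N) /\ (s <= \sum_i y i)%N.

Definition has_edge m : bool :=
  [exists i, (w i <= m i) && (w (ordS i) <= m (ordS i))]%N.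

Definition rounded_weight (C : {set 'I_N}) m : nat := \sum_(v in C) m v %/ w v.

Lemma ordS_neq (i : 'I_N) : ordS i != i.
Proof.
apply/eqP => /(congr1 (@nat_of_ord _)).
by case: (ordS_case i) => [[_ ->]|[-> ->]]; lia.
Qed.

Lemma edge_mnm_le i m :
  (edge_mnm i <= m)%MM = ((w i <= m i) && (w (ordS i) <= m (ordS i)))%N.
Proof.
have ne := ordS_neq i.
apply/mnm_lepP/andP => [le_m|[le_i le_Si] j].
  have := le_m i; have := le_m (ordS i).
  rewrite /edge_mnm !mnmDE !mulmnE !mnm1E !eqxx eq_sym (negPf ne) !mul1n.
  by rewrite mul0n add0n addn0.
rewrite /edge_mnm !mnmDE !mulmnE !mnm1E; have [<-|ne_ij] := eqVneq i j.
  by rewrite (negPf ne) mul1n mul0n addn0.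
by have [<-|] := eqVneq (ordS i) j; rewrite ?mul0n // mul1n.
Qed.

Lemma has_edgeP m : reflect (exists i, (edge_mnm i <= m)%MM) (has_edge m).
Proof.
by apply: (iffP existsP) => -[i]; rewrite -?edge_mnm_le => h; exists i; rewrite -?edge_mnm_le.
Qed.

Lemma has_edgeD m1 m2 : has_edge m2 -> has_edge (m1 + m2)%MM.
Proof.
move=> /has_edgeP[i le_i]; apply/has_edgeP; exists i.
by apply: lepm_trans le_i _; apply: lem_addl.
Qed.

Lemma edge_productD a b m1 m2 :
  edge_product a m1 -> edge_product b m2 -> edge_product (a + b) (m1 + m2)%MM.
Proof.
move=> [y [hy le_a]] [z [hz le_b]]; exists (fun i => y i + z i)%N; split=> [i|].
  by have := leq_add (hy i) (hz i); rewrite mnmDE -mulnDl addnACA.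
by rewrite big_split; apply: leq_add.
Qed.

Lemma edge_product0 m : edge_product 0 m.
Proof. by exists (fun=> 0%N). Qed.

Lemma edge_product_upward s m1 m2 : edge_product s m2 -> edge_product s (m1 + m2)%MM.
Proof. exact: edge_productD (edge_product0 m1). Qed.

Lemma edge_mnmE i j :
  edge_mnm i j = (((i == j) + (i == ord_pred j)) * w j)%N.
Proof.
rewrite /edge_mnm mnmDE !mulmnE !mnm1E mulnDl; congr (_ + _)%N.
  by case: eqP => [->|].
by rewrite -(can2_eq (@ordSK _) (@ord_predK _)); case: eqP => [->|].
Qed.

Lemma edge_product1 m : has_edge m -> edge_product 1 m.
Proof.
move=> /has_edgeP[i le_im]; rewrite -[m](submK le_im).
apply: edge_product_upward; exists (fun j => (ordS i == j) : nat); split=> [j|].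
  rewrite edge_mnmE leq_mul2r; apply/orP; right.
  by rewrite (inj_eq (@ordS_inj _)) -(can2_eq (@ordSK _) (@ord_predK _)) addnC.
by rewrite (bigD1 (ordS i)) //= eqxx.
Qed.

Lemma edge_product_mnm s m :
  edge_product s m ->
  exists (m' : 'X_{1..N}) (y : 'I_N -> nat),
    m = (m' + \sum_i edge_mnm i *+ y i)%MM /\ (s <= \sum_i y i)%N.
Proof.
(* The monomial [edge_mnm i] belongs to the edge from [i] to [ordS i], whose multiplicity is
   [y (ordS i)]. *)
move=> [y [hy le_s]]; exists (m - \sum_i edge_mnm i *+ y (ordS i))%MM, (y \o (@ordS _)).
split; last by rewrite /= (sum_ordS y).
rewrite submK //; apply/mnm_lepP => j; rewrite mnm_sumE.
apply: leq_trans (hy j); rewrite (bigD1 j) //= (bigD1 (ord_pred j)) /=; last first.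
  by rewrite (can2_eq (@ord_predK _) (@ordSK _)) eq_sym ordS_neq.
rewrite big1 => [|i /andP[/negPf ne_ij /negPf ne_ipj]].
  rewrite addn0 !mulmnE !edge_mnmE !eqxx ord_predK.
  have /negPf ne : j != ord_pred j by rewrite -(can2_eq (@ordSK _) (@ord_predK _)) ordS_neq.
  by rewrite ne eq_sym ne; lia.
by rewrite mulmnE edge_mnmE ne_ij ne_ipj.
Qed.

(** Weak duality: every edge of the product has an end in [C] and uses one unit of the rounded
    exponent there. *)
Lemma edge_product_covers s m :
  edge_product s m -> forall C, vertex_cover C -> (s <= rounded_weight C m)%N.
Proof.
move=> [y [hy le_s]] C /forallP hC; apply: leq_trans le_s _.
apply: (@leq_trans (\sum_(v in C) (y v + y (ordS v)))); last first.
  by apply: leq_sum => v _; rewrite leq_divRL.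
rewrite sum_mem_ord; under [X in (_ <= X)%N]eq_bigr => i _ do rewrite mulnDr.
rewrite big_split /= -(sum_ordS y) -(sum_ordS (fun i => (i \in C) * y i)%N) -big_split.
apply: leq_sum => i _ /=.
by have := hC i; case: (i \in C); case: (ordS i \in C); lia.
Qed.

Lemma edge_product_weight s m :
  edge_product s m -> (2 * s <= \sum_v m v %/ w v)%N.
Proof.
move=> [y [hy le_s]]; apply: (@leq_trans (\sum_v (y v + y (ordS v)))).
  rewrite big_split /= (sum_ordS y).
  by rewrite mul2n -addnn leq_add.
by apply: leq_sum => v _; rewrite leq_divRL.
Qed.

Lemma covers_edge_product s m :
  (forall C, vertex_cover C -> s <= rounded_weight C m)%N ->
  (2 * s <= \sum_v m v %/ w v)%N -> edge_product s m.
Proof.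
move=> hcov hsum; have [y [hy le_s]] := odd_cycle_konig hcov hsum n_gt0.
by exists y; split=> // i; rewrite -leq_divRL.
Qed.

Variable I : R -> Prop.
Hypothesis I_monomial : forall f, I f <-> monomial_ideal has_edge f.

Lemma ideal_pow_monomial s f :
  ideal_pow I s f <-> monomial_ideal (edge_product s) f.
Proof.
split.
  apply: ideal_gen_sub => [|_ [g [Ig ->]]].
    exact/monomial_ideal_ideal/edge_product_upward.
  elim: s g Ig => [|s IHs] g Ig; first by move=> m _; apply: edge_product0.
  rewrite big_ord_recl; apply: (monomial_idealM (@edge_productD 1 s : forall m1 m2, _ -> _ -> edge_product s.+1 _)); last exact: IHs.
  by move=> m mg; apply: edge_product1; move/I_monomial: (Ig ord0); apply.
apply: monomial_ideal_sub => [|m /edge_product_mnm[m' [y [-> le_s]]]].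
  exact: ideal_gen_ideal.
rewrite mpolyXD; case: (ideal_gen_ideal (ideal_prod I s)) => _ _; apply.
apply: ideal_prod_le le_s _; rewrite (big_morph _ (@mpolyXD _ K) (@mpolyX0 _ K)).
elim/big_ind2: _ => [|a p b q|i _]; [exact: ideal_prod0 | exact: ideal_prodM |].
rewrite -mpolyXn; apply: ideal_prodX; apply/I_monomial/monomial_idealX.
by apply/has_edgeP; exists i; apply: lepm_refl.
Qed.

Definition cover_degree (C : {set 'I_N}) m : nat := \sum_(v in C) m v.

Lemma cover_degreeD C m1 m2 :
  cover_degree C (m1 + m2)%MM = (cover_degree C m1 + cover_degree C m2)%N.
Proof. by rewrite -big_split; apply: eq_bigr => v _; rewrite mnmDE. Qed.

Lemma cover_degree_eq0 C m v : cover_degree C m = 0%N -> v \in C -> m v = 0%N.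
Proof. by move=> /eqP; rewrite sum_nat_eq0 => /forall_inP h /h /eqP. Qed.

(** This is the prime generated by the variables of [C]: a monomial has nonzero [cover_degree] iff
    one of them divides it. *)
Definition cover_prime (C : {set 'I_N}) : R -> Prop :=
  monomial_ideal (fun m => cover_degree C m != 0%N).

Lemma cover_prime_prime C : is_prime_ideal (cover_prime C).
Proof.
have up m1 m2 : cover_degree C m2 != 0%N -> cover_degree C (m1 + m2)%MM != 0%N.
  by rewrite cover_degreeD addn_eq0 negb_and orbC => ->.
split=> [||f g pfg]; first exact: monomial_ideal_ideal.
  move=> /(_ 0%MM); rewrite msupp1 mem_head => /(_ isT) /negP; apply.
  by rewrite sum_nat_eq0; apply/forall_inP => v _; rewrite mnm0E.
have [low|/hasPn pf] := boolP (has (fun m => cover_degree C m == 0%N) (msupp f)).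
  right; apply: (monomial_ideal_primary (cover_degreeD C) up _ low pfg) => m1 m2.
  by rewrite cover_degreeD => ->.
by left=> m /pf.
Qed.

Lemma cover_prime_assoc C : minset (@vertex_cover N) C -> assoc_prime I (cover_prime C).
Proof.
move=> /minsetP[covC minC]; split; first exact: cover_prime_prime.
(* Exponents are full off [C] and one short on [C], so no edge divides this monomial. By minimality,
   removing [v] from [C] uncovers an edge, and multiplying by [x_v] makes both of its ends full. *)
pose mC : 'X_{1..N} := [multinom (if v \in C then (w v).-1 else w v) | v < N].
exists 'X_[mC] => g; rewrite I_monomial monomial_idealMX.
split=> [pg m mg|Ig m mg]; last first.
  apply/negP => /eqP deg0.
  have /existsP[i /andP[]] := Ig m mg; have := forallP covC i.
  rewrite !mnmDE !mnmE => /orP[] inC; rewrite inC (cover_degree_eq0 deg0 inC).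
    by have := w_gt0 i; lia.
  by have := w_gt0 (ordS i); lia.
have := pg m mg; rewrite sum_nat_eq0 negb_forall => /existsP[v].
rewrite negb_imply -lt0n => /andP[vC mv_gt0].
have : ~~ vertex_cover (C :\ v).
  apply/negP => /minC /(_ (subsetDl _ _)) eqC.
  by move: vC; rewrite -eqC !inE eqxx.
rewrite negb_forall => /existsP[i]; rewrite negb_or !inE !negb_and !negbK.
have full u : u \notin C -> (w u <= (mC + m)%MM u)%N.
  by move=> /negPf uC; rewrite mnmDE mnmE uC leq_addr.
have fullv : (w v <= (mC + m)%MM v)%N by rewrite mnmDE mnmE vC; lia.
have ok u : (u == v) || (u \notin C) -> (w u <= (mC + m)%MM u)%N.
  by case/orP => [/eqP->|/full].
by move=> /andP[/ok le_i /ok le_Si]; apply/existsP; exists i; rewrite le_i.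
Qed.

(** Localize at the prime of a minimal cover inside [C]: some [u] outside the prime has [u * f] in
    the ordinary power, where weak duality applies, and [monomial_ideal_primary] removes [u]. *)
Lemma symbolic_pow_covers s f :
  symbolic_pow I s f ->
  forall m, m \in msupp f -> forall C, vertex_cover C -> (s <= rounded_weight C m)%N.
Proof.
move=> symf m mf C /vertex_cover_minset[C' minC' subC].
apply: leq_trans (leq_sum_sub _ subC).
have covC' : vertex_cover C' by case/minsetP: minC'.
have [u [pu /ideal_pow_monomial powuf]] := symf _ (cover_prime_assoc minC').
have low : has (fun m => cover_degree C' m == 0%N) (msupp u).
  by apply/negPn/negP => /hasPn h; apply: pu => m' /h.
pose good m := (s <= rounded_weight C' m)%N.
apply: (monomial_ideal_primary (good := good) (cover_degreeD C') _ _ low _ mf).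
- move=> m1 m2 /leq_trans; apply; apply: leq_sum => v _.
  by rewrite leq_div2r // mnmDE leq_addl.
- move=> m1 m2 deg0; rewrite /good /rounded_weight; congr (_ <= _)%N.
  by apply: eq_bigr => v vC; rewrite mnmDE (cover_degree_eq0 deg0 vC).
- by move=> m' m'uf; apply: edge_product_covers (powuf _ m'uf) _ covC'.
Qed.

(** The irrelevant ideal is not associated to [I]. If [m] has no edge but every [x_v m] has one,
    then every vertex has a neighbour [u] with [w u <= m u]; such a [u] and a full neighbour of it
    form an edge in [m]. *)
Lemma assoc_prime_proper p : assoc_prime I p -> exists v, ~ p 'X_v.
Proof.
move=> [[_ p1 _] [f annf]].
have [allf|] := boolP (all has_edge (msupp f)).
  by case: p1; apply/annf; rewrite mul1r; apply/I_monomial => m /(allP allf).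
move=> /allPn[m mf noedge].
have shift v : p 'X_v -> has_edge (U_(v) + m)%MM.
  move=> /annf; rewrite mulrC => /I_monomial /monomial_idealMX; exact.
have full_nbr v : has_edge (U_(v) + m)%MM ->
    exists2 u, (w u <= m u)%N & (u == ordS v) || (v == ordS u).
  move=> /existsP[i]; have := noedge; rewrite negb_exists => /forallP/(_ i).
  rewrite !mnmDE !mnm1E; have [->|ne_vi] := eqVneq v i.
    rewrite eq_sym (negPf (ordS_neq i)) add0n => _ /andP[_ le_Si].
    by exists (ordS i); rewrite ?eqxx.
  have [ev|ne_vSi] := eqVneq v (ordS i); last by rewrite !add0n => /negPf ->.
  by rewrite add0n => _ /andP[le_i _]; exists i; rewrite ?ev ?eqxx ?orbT.
have [/forallP allv|] := boolP [forall v, has_edge (U_(v) + m)%MM]; last first.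
  by rewrite negb_forall => /existsP[v /negP nv]; exists v => /shift.
have [u full_u _] := full_nbr ord0 (allv ord0).
have [u' full_u' adj] := full_nbr u (allv u).
case/negP: noedge; apply/existsP.
case/orP: adj => /eqP e; first by exists u; rewrite full_u -e.
by exists u'; rewrite full_u' -e.
Qed.

(** Every associated prime omits some variable, and a power of that variable serves as the
    denominator. *)
Lemma symbolic_powX s m :
  (forall v, exists k, edge_product s (U_(v) *+ k + m)%MM) ->
  symbolic_pow I s 'X_[m].
Proof.
move=> tor p assp; have [v pv] := assoc_prime_proper assp.
have [k prodk] := tor v; exists ('X_v ^+ k); split; last first.
  by apply/ideal_pow_monomial; rewrite mpolyXn -mpolyXD; apply/monomial_idealX.
have [[_ p1 pM] _] := assp.
by elim: k {prodk} => [|k IHk] //; rewrite exprS => /pM[].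
Qed.

(** The added power raises the rounded exponent at [v] by [2 * s], which alone gives the bound on
    the total; the cover bounds can only improve. *)
Lemma symbolic_pow_torsion s f v :
  symbolic_pow I s f -> ideal_pow I s (f * 'X_v ^+ (2 * s * w v)).
Proof.
move=> symf; apply/ideal_pow_monomial; rewrite mpolyXn.
apply/monomial_idealMX => m mf; apply: covers_edge_product => [C covC|].
  apply: leq_trans (symbolic_pow_covers symf mf covC) _; apply: leq_sum => u _.
  by rewrite leq_div2r // mnmDE leq_addl.
rewrite (bigD1 v) //=; apply: leq_trans (leq_addr _ _).
by rewrite mnmDE mulmnE mnm1E eqxx mul1n divnMDl // leq_addr.
Qed.

Lemma symbolic_pow_degree s wv f m :
  (forall i, w i + w (ordS i) <= wv.+1)%N ->
  symbolic_pow I s f -> m \in msupp f ->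
  edge_product s m \/
  [/\ (n.+1 <= s)%N
    & (mdeg m + N <= 2 * (\sum_i w i) + (s - n.+1) * wv.+1)%N].
Proof.
move=> hw symf mf; have hcov := symbolic_pow_covers symf mf.
have [le_s|lt_s] := leqP (2 * s) (\sum_v m v %/ w v).
  by left; apply: covers_edge_product.
right; have [le_ns le_sum] := weighted_degree_bound hcov lt_s hw; split=> //.
(* Division with remainder gives [m i + 1 <= w i * (m i %/ w i) + w i]; the ones sum to [N]. *)
apply: (@leq_trans (\sum_i w i * (m i %/ w i) + \sum_i w i)).
  rewrite mdegE -[X in (_ + X <= _)%N](card_ord N) -sum1_card -!big_split.
  apply: leq_sum => i _ /=; rewrite {1}(divn_eq (m i) (w i)) mulnC -addnA leq_add2l.
  by rewrite addn1 ltn_mod.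
by rewrite [X in (_ <= X + _)%N]mul2n -addnn addnAC leq_add2r.
Qed.

(** The exponent of [m] at [i] is the largest with quotient [b i]. The total of [b] is [2s - 1], one
    unit short of an edge product, and multiplying by any [x_u ^ w u] supplies that unit. A cover
    has at least [n + 1] vertices and meets the edge at [v], so its weight is at least [s]. *)
Lemma extremal_monomial s v : (n.+1 <= s)%N ->
  let b i := (((i == v) + (i == ordS v)) * (s - n.+1)).+1 in
  let m := [multinom (w i * b i + (w i).-1)%N | i < N] in
  [/\ symbolic_pow I s 'X_[m], ~ edge_product s m
    & (mdeg m + N = 2 * (\sum_i w i) + (s - n.+1) * (w v + w (ordS v)))%N].
Proof.
move=> le_ns b m; pose k := (s - n.+1)%N.
have mE i : m i = (w i * b i + (w i).-1)%N by rewrite mnmE.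
have quo i : (m i %/ w i)%N = b i.
  by rewrite mE mulnC divnMDl // divn_small ?addn0 // prednK.
have sum_ends (F : 'I_N -> nat) :
    (\sum_i ((i == v) + (i == ordS v)) * F i = F v + F (ordS v))%N.
  under eq_bigr => i _ do rewrite mulnDl.
  rewrite big_split (bigD1 v) //= [X in (_ + X)%N](bigD1 (ordS v)) //= !eqxx !mul1n.
  by rewrite !big1 ?addn0 //; move=> i /negPf ->.
have sumb : (\sum_i b i = N + 2 * k)%N.
  under eq_bigr => i _ do rewrite /b -add1n.
  by rewrite big_split sum1_card card_ord (sum_ends (fun=> k)) addnn -mul2n.
split.
- apply: symbolic_powX => u; exists (w u); apply: covers_edge_product.
    move=> C covC; apply: (@leq_trans (\sum_(i in C) b i)); last first.
      apply: leq_sum => i _; rewrite -quo leq_div2r //.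
      by rewrite [X in (_ <= X)%N]mnmDE leq_addl.
    under eq_bigr => i _ do rewrite /b -add1n.
    rewrite big_split sum1_card -[X in (X <= _)%N](subnKC le_ns); apply: leq_add (vertex_cover_card covC) _.
    have /orP[inC|inC] := forallP covC v.
      by rewrite (bigD1 v) //=; apply: leq_trans (leq_addr _ _); rewrite leq_pmull // eqxx.
    by rewrite (bigD1 (ordS v)) //=; apply: leq_trans (leq_addr _ _); rewrite leq_pmull // eqxx addnS.
  have : (\sum_i (U_(u) *+ w u + m)%MM i %/ w i = \sum_i ((i == u) + b i))%N.
    apply: eq_bigr => i _; rewrite mnmDE mulmnE mnm1E -quo eq_sym.
    by have [->|_] := eqVneq i u; [rewrite divnMDl | rewrite mul0n].
  move=> ->; rewrite big_split sumb /= (bigD1 u) //= eqxx.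
  by rewrite big1 => [|i /negPf ->] //; rewrite /k; lia.
- move=> /edge_product_weight; rewrite (eq_bigr b) // sumb /k; lia.
- rewrite mdegE; have -> : (\sum_i m i = \sum_i (w i * b i + (w i).-1))%N.
    by apply: eq_bigr => i _; exact: mE.
  rewrite -[X in (_ + X = _)%N](card_ord N) -sum1_card -big_split /=.
  under eq_bigr => i _ do
    rewrite -addnA addn1 prednK // /b mulnS [(w i * _)%N]mulnC -mulnA.
  rewrite !big_split /= sum_ends -/k; lia.
Qed.

End WeightedOddCycle.

(** * From sink weights to edge monomials *)

Section SinkWeightedCycle.
Variables (K : fieldType) (n : nat) (D : wograph 'I_(2 * n).+1).
Hypothesis hcycle : forall x y, underlying D x y = cycle_graph x y.
Hypothesis hsink : forall x, x \in Vplus D -> sink D x.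

Lemma weight_tail x y : Defs.arc D x y -> weight D x = 1%N.
Proof.
move=> xy; apply/eqP/negPn/negP => wx.
by have /hsink/(_ y) : x \in Vplus D by [rewrite inE]; rewrite xy.
Qed.

(** The tail of an arc is not a sink and so has weight 1; the generator is then symmetric in the two
    ends. *)
Lemma arc_edge_mnm x y : Defs.arc D x y ->
  exists i, 'X_x * 'X_y ^+ weight D y = 'X_[edge_mnm (weight D) i] :> {mpoly K[_]}.
Proof.
move=> xy; rewrite mpolyXn -mpolyXD /edge_mnm.
have : cycle_graph x y by rewrite -hcycle /underlying /= xy.
move=> /orP[] /eqP e.
  by exists x; rewrite -e (weight_tail xy) mulm1n.
by exists y; rewrite -e (weight_tail xy) mulm1n addmC.
Qed.

Lemma edge_mnm_arc i : exists x y, Defs.arc D x y /\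
  'X_[edge_mnm (weight D) i] = 'X_x * 'X_y ^+ weight D y :> {mpoly K[_]}.
Proof.
have : underlying D i (ordS i) by rewrite hcycle /cycle_graph /= eqxx.
move=> /orP[] ar; [exists i, (ordS i) | exists (ordS i), i]; split=> //.
  by rewrite mpolyXn -mpolyXD /edge_mnm (weight_tail ar) mulm1n.
by rewrite mpolyXn -mpolyXD /edge_mnm (weight_tail ar) mulm1n addmC.
Qed.

Hypothesis n_gt0 : (0 < n)%N.

Lemma edge_ideal_monomial (f : {mpoly K[_]}) :
  edge_ideal D f <-> monomial_ideal (has_edge (weight D)) f.
Proof.
split.
  apply: ideal_gen_sub => [|_ [x [y [xy ->]]]].
    exact/monomial_ideal_ideal/has_edgeD.
  have [i ->] := arc_edge_mnm xy; apply/monomial_idealX.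
  by apply/(has_edgeP n_gt0); exists i; apply: lepm_refl.
apply: monomial_ideal_sub => [|m /(has_edgeP n_gt0)[i le_im]].
  exact: ideal_gen_ideal.
rewrite -(submK le_im) mpolyXD.
case: (ideal_gen_ideal (R := {mpoly K[(2 * n).+1]})
  (fun g => exists x y, Defs.arc D x y /\ g = 'X_x * 'X_y ^+ weight D y)) => _ _; apply.
apply: ideal_gen_incl; have [x [y [xy ->]]] := edge_mnm_arc i.
by exists x, y.
Qed.

Lemma weight_edge i : weight D i = 1%N \/ weight D (ordS i) = 1%N.
Proof.
have : underlying D i (ordS i) by rewrite hcycle /cycle_graph /= eqxx.
by case/orP => /weight_tail; [left | right].
Qed.

Lemma edge_weight_le i : Vplus D != set0 ->
  (weight D i + weight D (ordS i) <= (\max_(x in Vplus D) weight D x).+1)%N.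
Proof.
move=> /set0Pn[v vV]; set wv := (\max_(x in _) _)%N.
have le_max x : (weight D x <= wv)%N.
  have [xV|] := boolP (x \in Vplus D); first exact: leq_bigmax_cond.
  rewrite inE negbK => /eqP ->; apply: leq_trans (weight_gt0 D v) _.
  exact: leq_bigmax_cond.
by case: (weight_edge i) => ->; rewrite ?add1n ?addn1 ltnS.
Qed.

Lemma heaviest_edge : Vplus D != set0 ->
  exists v, (weight D v + weight D (ordS v) = (\max_(x in Vplus D) weight D x).+1)%N.
Proof.
rewrite -card_gt0 => /(eq_bigmax_cond (weight D))[v vV ->]; exists v.
case: (weight_edge v) => [wv|->]; last by rewrite addn1.
by move: vV; rewrite inE wv.
Qed.

Lemma sum_weight :
  (\sum_i weight D i = (2 * n).+1 + \sum_(x in Vplus D) (weight D x - 1))%N.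
Proof.
rewrite -[in X in (_ = X + _)%N](card_ord (2 * n).+1) -sum1_card.
rewrite [X in (_ + X)%N]big_mkcond -big_split; apply: eq_bigr => i _ /=.
rewrite inE; case: eqP => [->|] //= _.
by rewrite subnKC // weight_gt0.
Qed.

End SinkWeightedCycle.

(** * Dimension and local cohomology of torsion quotients *)

Section FiniteLength.
Variables (K : fieldType) (d : nat).
Local Notation R := {mpoly K[d]}.
Variables (J I : R -> Prop).
Hypothesis idealI : is_ideal I.
Variable k : 'I_d -> nat.
Hypothesis torsion : forall f v, J f -> I (f * 'X_v ^+ k v).

Lemma irrelevant_ideal_sub (p : R -> Prop) f :
  is_ideal p -> (forall v, p 'X_v) -> f@_0%MM = 0 -> p f.
Proof.
move=> idp pX f0; rewrite (mpolyE f) big_seq; apply: ideal_sum => // m mf.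
rewrite -mul_mpolyC; case: idp => _ _ pM; apply: (pM).
have [v mv] : exists v, m v != 0%N.
  apply/existsP; rewrite -negb_forall; apply: contraTN mf => /forallP m0.
  have -> : m = 0%MM by apply/mnmP => i; rewrite mnm0E; apply/eqP/m0.
  by rewrite mcoeff_msupp f0 eqxx.
have /submK <- : (U_(v) <= m)%MM by rewrite lep1mP.
by rewrite mpolyXD; apply: pM.
Qed.

(** Powers of all variables annihilate the quotient, so the first prime contains every variable. A
    strictly larger ideal contains an element with nonzero constant term, hence [1]. *)
Lemma le_dim_finite_length i : le_dim J I i -> i = 0%N.
Proof.
move=> [p [prime_p ann_p chain]]; case: i => // i in prime_p chain *.
have [id0 p0 pM0] := prime_p 0%N isT; have [id1 p1 _] := prime_p 1%N isT.
have pX v : p 0%N 'X_v.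
  have : p 0%N ('X_v ^+ k v).
    by apply: ann_p => f Jf; rewrite mulrC; apply: torsion.
  by elim: (k v) => [|e IHe]; rewrite ?expr0 // exprS => /pM0[].
have [sub01 [f [p1f p0f]]] := chain 0%N isT.
have f0 : f@_0%MM != 0.
  by apply/eqP => f0; apply: p0f; apply: irrelevant_ideal_sub.
case: p1; case: id1 => _ pD pMul.
have -> : 1 = (f@_0%MM)^-1%:MP * f + - (f@_0%MM)^-1%:MP * (f - (f@_0%MM)%:MP) :> R.
  by rewrite mulNr mulrBr opprB addrC subrK -mpolyCM mulVf // mpolyC1.
apply: pD; first exact: pMul.
apply: (pMul); apply: (sub01); apply: irrelevant_ideal_sub => //.
by rewrite mcoeffB mcoeffC eqxx mulr1 subrr.
Qed.

(** The chain is the irrelevant ideal alone. An annihilator [f] has [f * 'X_[m]] in [I], so the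
    coefficient at [m], which is the constant term of [f], vanishes. *)
Lemma le_dim0 m : J 'X_[m] -> (forall f, I f -> m \notin msupp f) -> le_dim J I 0.
Proof.
move=> Jm nIm; exists (fun _ f => f@_0%MM = 0); split=> // [t _|f annf].
- split=> [||f g].
  + split=> [|f g|f g]; first exact: mcoeff0.
      by rewrite mcoeffD => -> ->; rewrite addr0.
    by rewrite rmorphM => /= ->; rewrite mulr0.
  + by rewrite mcoeff1 eqxx; apply/eqP/oner_neq0.
  + by rewrite rmorphM => /eqP; rewrite mulf_eq0 => /orP[] /eqP; [left|right].
- have := nIm _ (annf _ Jm); rewrite -mcoeff_eq0 -(mcoeffMX f m) addm0.
  by move/eqP.
Qed.

(** By torsion every element of [J] is a 0-cocycle, and since the empty product of variables is [1],
    the coboundaries are the elements of [I]. Thus the zeroth local cohomology is the whole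
    quotient. *)
Lemma lc_nonzero0 j :
  lc_nonzero J I 0 j <-> exists f, [/\ J f, homog_int j f & ~ I f].
Proof.
split=> [[e [a [cha _ nba]]]|[f [Jf jf nIf]]].
  have [Ja ja] := cha set0 (cards0 _); rewrite cards0 muln0 addr0 in ja.
  exists (a set0); split=> // Ia; apply: nba; exists 0%N, (fun=> 0); split=> // T.
  move=> /eqP; rewrite cards_eq0 => /eqP ->; exists 0%N.
  by rewrite /cech_diff big_set0 !expr0 !mul1r mulr0 subr0.
exists 0%N, (fun=> f); split.
- by move=> S /eqP; rewrite cards_eq0 => /eqP ->; rewrite cards0 muln0 addr0.
- move=> T /eqP/cards1P[v ->]; exists (k v).
  rewrite /xprod big_set1 /cech_diff big_set1 !expr0 !mul1r subr0.
  by rewrite mulrCA [X in _ * X]mulrC; case: idealI => _ _; apply; apply: torsion.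
- move=> [l [b [_ /(_ set0 (cards0 _))[e]]]].
  by rewrite /xprod /cech_diff !big_set0 !expr1n !mul1r subr0.
Qed.

End FiniteLength.

(** * Regularity of the quotient *)

Theorem theorem4p4 (K : fieldType) (n : nat) (hn : (1 <= n)%N)
    (D : wograph 'I_(2 * n).+1)
    (hcycle : forall x y, underlying D x y = cycle_graph x y)
    (hVplus : Vplus D != set0)
    (hsink : forall x, x \in Vplus D -> sink D x)
    (s : nat) (hs : (n.+1 <= s)%N) :
  let I := @edge_ideal K _ D in
  let wv := (\max_(x in Vplus D) weight D x)%N in
  let w := (\sum_(x in Vplus D) (weight D x - 1))%N in
  reg_eq (symbolic_pow I s) (ideal_pow I s)
    ((s%:Z - n%:Z - 1) * (1 + wv%:Z) + 2 * w%:Z + 2 * n%:Z + 1).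
Proof.
move=> I wv w.
have IE := edge_ideal_monomial (K := K) hcycle hsink hn; rewrite -/I in IE.
have w_gt0 := weight_gt0 D.
have powE := ideal_pow_monomial hn IE s.
have tor f v := symbolic_pow_torsion hn w_gt0 IE (s := s) (f := f) v.
have idI : is_ideal (ideal_pow I s) by apply: ideal_gen_ideal.
have [v ev] := heaviest_edge hcycle hsink hVplus.
have := extremal_monomial hn w_gt0 IE v hs; rewrite /= ev sum_weight -/w -/wv.
move: [multinom _ | _ < _] => m [symm nprodm degm].
(* In [degm] the sum of all weights is [2n + 1] plus [w]; as [n.+1 <= s], the truncated subtraction
   there agrees with the integer one. *)
have -> : (s%:Z - n%:Z - 1) * (1 + wv%:Z) + 2 * w%:Z + 2 * n%:Z + 1 = (mdeg m)%:Z.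
  by nia.
have lc0 := lc_nonzero0 idI tor.
have a0 : a_inv_eq (symbolic_pow I s) (ideal_pow I s) 0 (Some (mdeg m)%:Z).
  split=> [|j /lc0[f [symf jf nIf]]].
    apply/lc0; exists 'X_[m]; split=> //=; first by rewrite dhomogX eqxx.
    by move/powE/monomial_idealX.
  case: j jf => // e /dhomog_mf he; rewrite lez_nat leqNgt; apply/negP => lt_e.
  (* A form of degree above [mdeg m] has all its monomials in the ordinary power, by the degree
     bound. *)
  apply: nIf; apply/powE => m' m'f.
  have le_w i := edge_weight_le hcycle hsink i hVplus.
  have [//|[_]] := symbolic_pow_degree hn w_gt0 IE le_w symf m'f.
  by rewrite sum_weight -/w -/wv (he _ m'f); lia.
have dim0 := le_dim_finite_length tor.
split; last by move=> i /dim0 ->; exists (Some (mdeg m)%:Z); rewrite addr0.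
exists 0%N, (mdeg m)%:Z; rewrite addr0; split=> //.
apply: (le_dim0 symm) => f /powE prodf; apply/negP => /prodf; exact: nprodm.
Qed.
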